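(* The group $\mathrm{Sol}$ does not admit a continuous quasitransitive action on a locally finite non-amenable graph.
   Context: $\mathrm{Sol}$ is the (discrete) semidirect product $\mathbb{Z}^2\rtimes\mathbb{Z}$, where the generator of $\mathbb{Z}$ acts on $\mathbb{Z}^2$ via the matrix $\begin{pmatrix}2&1\\1&1\end{pmatrix}$. Actions on graphs are by graph automorphisms (and are not assumed proper here); an action is quasitransitive if there are only finitely many orbits of vertices. For a set $A$ of vertices of a graph $\Gamma$, $\partial A$ is the set of vertices not in $A$ that have a neighbour in $A$. The Cheeger constant is $\mathrm{h}(\Gamma)=\inf |\partial A|/|A|$ over finite non-empty sets $A$ of vertices; $\Gamma$ is amenable if $\mathrm{h}(\Gamma)=0$ and non-amenable otherwise. *)

(* Defs.v *)
From HB Require Import structures.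
From mathcomp Require Import all_boot all_order all_algebra finmap.
From mathcomp Require Import all_classical all_reals topology.

Set Implicit Arguments.
Unset Strict Implicit.
Unset Printing Implicit Defensive.

Import Order.TTheory GRing.Theory Num.Theory.

Local Open Scope classical_set_scope.
Local Open Scope ring_scope.

Definition sol_mx : 'M[int]_2 :=
  \matrix_(i < 2, j < 2) (if (i == 0) && (j == 0) then 2 else 1).

Lemma sol_mx_unit : sol_mx \is a GRing.unit.
Proof.
rewrite -[_ \is a _]/(sol_mx \in unitmx) unitmxE.
by rewrite (expand_det_row _ 0) !big_ord_recl big_ord0 /cofactor !det_mx11 !mxE.
Qed.

(* The pair (u, m) is u t^m, where the generator t of Z satisfies
   t v t^-1 = sol_mx *m v. *)
Definition Sol : Type := ('cV[int]_2 * int)%type.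

HB.instance Definition _ := Choice.on Sol.

Definition sol_one : Sol := (0, 0).

Definition sol_mul (g h : Sol) : Sol :=
  (g.1 + sol_mx ^ g.2 *m h.1, g.2 + h.2).

Definition sol_inv (g : Sol) : Sol := (- (sol_mx ^ (- g.2) *m g.1), - g.2).

Lemma sol_mulA : associative sol_mul.
Proof.
move=> [u m] [v n] [w p]; congr pair; rewrite /= ?addrA //.
by rewrite (exprzDr sol_mx_unit) mulmxDr mulmxA addrA.
Qed.

Lemma sol_mul1g : left_id sol_one sol_mul.
Proof. by move=> [u m]; congr pair; rewrite /= ?expr0z ?mul1mx !add0r. Qed.

Lemma sol_mulg1 : right_id sol_one sol_mul.
Proof. by move=> [u m]; congr pair; rewrite /= ?mulmx0 addr0. Qed.

Lemma sol_mulVg : left_inverse sol_one sol_inv sol_mul.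
Proof. by move=> [u m]; congr pair; rewrite /= addNr. Qed.

Lemma sol_mulgV : right_inverse sol_one sol_inv sol_mul.
Proof.
move=> [u m]; congr pair; rewrite /= ?subrr // mulmxN mulmxA.
have -> : sol_mx ^ m *m sol_mx ^ (- m) = 1%:M.
  by rewrite -[LHS]/(sol_mx ^ m * sol_mx ^ (- m)) -(exprzDr sol_mx_unit) subrr.
by rewrite mul1mx subrr.
Qed.

HB.instance Definition _ :=
  isGroup.Build Sol sol_mulA sol_mul1g sol_mulg1 sol_mulVg sol_mulgV.

(* Simple undirected graphs, possibly infinite and possibly disconnected. *)
Record graph := Graph {
  vertex :> choiceType;
  adj : rel vertex;
  adj_sym : symmetric adj;
  adj_irr : irreflexive adj
}.

Definition locally_finite (X : graph) : Prop :=
  forall x : X, finite_set [set y : X | adj x y].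

Definition vertex_boundary (X : graph) (A : set X) : set X :=
  [set y | ~ A y /\ exists2 x, A x & adj y x].

(* The cardinality of a boundary is computed by fset_set, which is only
   meaningful on finite sets; boundaries of finite sets are finite as soon as
   the graph is locally finite.  Similarly, inf is only meaningful for graphs
   with at least one vertex (inf set0 is 0 by convention). *)
Definition cheeger (R : realType) (X : graph) : R :=
  inf [set (#|` fset_set (vertex_boundary [set` A])|)%:R / (#|` A|)%:R
      | A in [set A : {fset X} | A != fset0]].

Definition amenable (R : realType) (X : graph) : Prop := cheeger R X = 0.

Record graph_action (G : groupType) (X : graph) := GraphAction {
  act :> G -> X -> X;
  act1 : forall x, act 1%g x = x;
  actM : forall g h x, act (g * h)%g x = act g (act h x);
  act_adj : forall g x y, adj (act g x) (act g y) = adj x y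
}.

(* The group and the vertex set both carry the discrete topology; continuity
   then holds for every action. *)
Definition continuous_action (G : groupType) (X : graph)
    (a : graph_action G X) : Prop :=
  continuous (fun gx : discrete_topology G * discrete_topology X =>
    a gx.1 gx.2 : discrete_topology X).

Definition orbit (G : groupType) (X : graph) (a : graph_action G X) (x : X) :
  set X := range (fun g => a g x).

Definition quasitransitive (G : groupType) (X : graph)
    (a : graph_action G X) : Prop :=
  finite_set (range (orbit a)).

(* Main.v *)
Require Import Defs.
From mathcomp Require Import all_boot all_order all_algebra finmap.
From mathcomp Require Import all_classical all_reals topology.
From mathcomp Require Import zify ring lra.

(** If the Cheeger constant were h > 0, every finite nonempty set A would satisfy
    #|N(A)| >= (1 + h) #|A|, where N is the closed neighbourhood, hence
    #|N^r(A)| >= (1 + h)^r #|A| for all r.  So it is enough to find a constant C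
    and, for each r, a finite nonempty A, allowed to depend on r, with
    #|N^r(A)| <= C (r + 1)^2 #|A| ([amenable_of_quadratic_growth]).  Constant
    factors are harmless in this criterion, so crude counting suffices.

    Fix a vertex x0.  For a vertex x let L_x be the group of the v in Z^2 with
    (v, 0) x = x.  Adjacent vertices have commensurable L's: v in L_x permutes
    the finitely many neighbours of x, so a fixed multiple of v fixes each of
    them.  Let T be a finite set of representatives, containing x0, of the orbits
    that meet the commensurability class of x0, all chosen inside that class.
    The neighbours of T then lie in Sol T, and finitely many elements (u, m) of
    Sol describe all the edges at T.
    Walking r steps from (v, 0) x with x in T leads to (v', m') z with z in T,
    |m'| = O(r) and |v' - v| at most exponential in r, because the matrix sol_mx
    and its inverse expand the sup norm by a factor at most 3
    ([iter_closed_nbhd_steps]).  Three cases remain.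

    - All edges at T have m = 0.  Then the walk never leaves Z^2 T, and the
      balls around x0 grow at most quadratically ([amenable_of_translation_steps]).

    - L_x0 = 0.  Take for A the translates of x0 by a box whose radius is the
      exponential bound K on |v' - v|.  Then A has (2K + 1)^2 points while N^r(A)
      lies in the union over |m'| = O(r) of images of the box of radius 2K, which
      costs only a factor O(r) ([amenable_of_free_translations]).

    - Some edge at T has m != 0, and L_x0 contains some v != 0.  By
      commensurability L_x0 contains nonzero multiples of v and of sol_mx^m v.
      These are linearly independent, as sol_mx^m has no rational eigenvector, so
      L_x0 has finite index in Z^2 ([fixes_finite_index]).  Hence some k Z^2, a normal
      subgroup of Sol, fixes Sol T pointwise, and balls around x0 grow at most linearly
      ([amenable_of_fixed_lattice]). *)

Set Implicit Arguments.
Unset Strict Implicit.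
Unset Printing Implicit Defensive.

Import Order.TTheory GRing.Theory Num.Theory.

Local Open Scope classical_set_scope.
Local Open Scope ring_scope.

(** * Expansion and amenability *)

Definition closed_nbhd (X : graph) (A : {fset X}) : {fset X} :=
  (A `|` fset_set (vertex_boundary [set` A]))%fset.

Lemma finite_vertex_boundary (X : graph) (A : {fset X}) :
  locally_finite X -> finite_set (vertex_boundary [set` A]).
Proof.
move=> lfX.
have finN : finite_set (\bigcup_(x in [set` A]) [set y | adj x y]).
  by apply: bigcup_finite => // x _; exact: lfX.
apply: sub_finite_set finN => y [_ [x Ax yx]].
by exists x => //=; rewrite adj_sym.
Qed.

Lemma closed_nbhdP (X : graph) (A : {fset X}) (y : X) :
  locally_finite X -> y \in closed_nbhd A ->
  y \in A \/ exists2 x, x \in A & adj x y.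
Proof.
move=> lfX; rewrite in_fsetU in_fset_set; last exact: finite_vertex_boundary.
case/orP => [|/set_mem [_ [x Ax yx]]]; [by left | right].
by exists x => //; rewrite adj_sym.
Qed.

Lemma card_closed_nbhd (X : graph) (A : {fset X}) : locally_finite X ->
  #|` closed_nbhd A| =
    (#|` A| + #|` fset_set (vertex_boundary [set` A])|)%N.
Proof.
move=> lfX; rewrite /closed_nbhd -cardfsUI.
suff -> : (A `&` fset_set (vertex_boundary [set` A]) = fset0)%fset.
  by rewrite cardfs0 addn0.
apply/fsetP => y; rewrite in_fsetI in_fset0 in_fset_set; last first.
  exact: finite_vertex_boundary.
by apply/negbTE/negP => /andP[yA /set_mem [+ _]]; apply.
Qed.

Lemma nonamenable_expansion (R : realType) (X : graph) :
  locally_finite X -> ~ amenable R X ->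
  exists2 h : R, 0 < h &
    forall A : {fset X}, A != fset0 ->
      (1 + h) * #|` A|%:R <= #|` closed_nbhd A|%:R.
Proof.
move=> lfX namX; exists (cheeger R X).
  rewrite lt0r; apply/andP; split; first exact/eqP.
  rewrite /cheeger; set E := image _ _.
  have [->|/set0P nE] := eqVneq E set0; first by rewrite inf0.
  by apply: lb_le_inf => // _ [A _ <-]; rewrite divr_ge0.
move=> A A0; rewrite card_closed_nbhd // natrD mulrDl mul1r lerD2l.
rewrite -ler_pdivlMr ?ltr0n ?cardfs_gt0 //.
apply: ge_inf; last by exists A.
by exists 0 => _ [B _ <-]; rewrite divr_ge0.
Qed.

Lemma iter_closed_nbhd_expansion (R : realType) (X : graph) (h : R)
    (A : {fset X}) (r : nat) :
  0 < h ->
  (forall B : {fset X}, B != fset0 ->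
      (1 + h) * #|` B|%:R <= #|` closed_nbhd B|%:R) ->
  A != fset0 ->
  (1 + h) ^+ r * #|` A|%:R <= #|` iter r (@closed_nbhd X) A|%:R.
Proof.
move=> h0 hexp A0.
suff [//] : iter r (@closed_nbhd X) A != fset0 /\
  (1 + h) ^+ r * #|` A|%:R <= #|` iter r (@closed_nbhd X) A|%:R.
elim: r => [|r [nB IH]]; first by rewrite expr0 mul1r.
have leB := hexp _ nB; split.
  rewrite -cardfs_gt0 -(ltr0n R); apply: lt_le_trans leB.
  by rewrite mulr_gt0 ?addr_gt0 // ltr0n cardfs_gt0.
by rewrite iterS; apply: le_trans leB; rewrite exprS -mulrA ler_pM2l // addr_gt0.
Qed.

(** The cube of Bernoulli's inequality, (1 + h)^(3n) >= (n h)^3, is cubic in the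
    exponent and beats any quadratic. *)
Lemma quadratic_lt_geometric (R : realType) (h : R) (C : nat) :
  0 < h -> exists r : nat, (C * r.+1 ^ 2)%:R < (1 + h) ^+ r.
Proof.
move=> h0.
have [n nC] : exists n : nat, (16 * C)%:R / h ^+ 3 < n.+1%:R.
  exists (Num.truncn ((16 * C)%:R / h ^+ 3)).
  exact: truncnS_gt.
exists (3 * n.+1)%N.
have bernoulli k : 1 + k%:R * h <= (1 + h) ^+ k.
  elim: k => [|k IH]; first by rewrite mul0r addr0.
  rewrite exprS; apply: le_trans (ler_wpM2l _ IH); last lra.
  have -> : (1 + h) * (1 + k%:R * h) = 1 + k.+1%:R * h + k%:R * (h * h).
    by rewrite -natr1; ring.
  by rewrite lerDl !mulr_ge0 // ltW.
have cube : (n.+1%:R * h) ^+ 3 <= (1 + h) ^+ (3 * n.+1).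
  have nh0 : 0 <= n.+1%:R * h by rewrite mulr_ge0 // ltW.
  rewrite mulnC exprM lerXn2r ?nnegrE ?exprn_ge0 //; first lra.
  by apply: le_trans (bernoulli n.+1); lra.
apply: lt_le_trans cube.
have leC : (C * (3 * n.+1).+1 ^ 2 <= 16 * C * n.+1 ^ 2)%N by nia.
apply: (@le_lt_trans _ _ (16 * C * n.+1 ^ 2)%N%:R); first by rewrite ler_nat.
rewrite natrM natrX exprMn [n.+1%:R ^+ 3]exprSr -mulrA [ltLHS]mulrC.
rewrite ltr_pM2l ?exprn_gt0 //.
by rewrite -ltr_pdivrMr ?exprn_gt0.
Qed.

(** Expansion by 1 + h is contradicted at a single large r, which is why A may
    depend on r. *)
Lemma amenable_of_quadratic_growth (R : realType) (X : graph) (C : nat) :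
  locally_finite X ->
  (forall r : nat, exists2 A : {fset X}, A != fset0 &
    (#|` iter r (@closed_nbhd X) A| <= C * r.+1 ^ 2 * #|` A|)%N) ->
  amenable R X.
Proof.
move=> lfX growth; apply: contrapT => /(nonamenable_expansion lfX)[h h0 hexp].
have [r Cr] := quadratic_lt_geometric C h0.
have [A A0] := growth r.
rewrite -(ler_nat R) leNgt => /negP; apply.
apply: lt_le_trans (iter_closed_nbhd_expansion r h0 hexp A0).
by rewrite natrM ltr_pM2r // ltr0n cardfs_gt0.
Qed.

(** * Boxes in Z^2 and powers of the matrix *)

Definition ints (n : nat) : seq int := [seq k%:Z - n%:Z | k <- iota 0 n.*2.+1].

Lemma mem_ints (n : nat) (z : int) : (z \in ints n) = (`|z| <= n)%N.
Proof.
apply/mapP/idP => [[k + ->]|zn]; first by rewrite mem_iota; lia.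
by exists (absz (z + n%:Z)); rewrite ?mem_iota; lia.
Qed.

Lemma size_ints (n : nat) : size (ints n) = n.*2.+1.
Proof. by rewrite size_map size_iota. Qed.

Lemma uniq_ints (n : nat) : uniq (ints n).
Proof. by rewrite map_inj_uniq ?iota_uniq // => x y; lia. Qed.

Definition vec2 (x y : int) : 'cV[int]_2 := \col_i (if i == 0 then x else y).

Lemma vec2_eta (v : 'cV[int]_2) : v = vec2 (v 0 0) (v 1 0).
Proof.
apply/colP => i; rewrite mxE; case: ifP => [/eqP -> // | i0].
by congr (v _ _); apply/val_inj; case: i i0 => [[|[|]]].
Qed.

Definition box (n : nat) : seq 'cV[int]_2 :=
  [seq vec2 x y | x <- ints n, y <- ints n].

Lemma mem_box (n : nat) (v : 'cV[int]_2) :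
  (v \in box n) = (`|v 0%R 0%R| <= n)%N && (`|v 1%R 0%R| <= n)%N.
Proof.
apply/allpairsP/idP => [[[x y] /= [+ + ->]]|].
  by rewrite !mem_ints !mxE /= => -> ->.
case/andP => v0 v1; exists (v 0 0, v 1 0).
by rewrite !mem_ints; split => //; exact: vec2_eta.
Qed.

Lemma size_box (n : nat) : size (box n) = (n.*2.+1 ^ 2)%N.
Proof. by rewrite size_allpairs !size_ints. Qed.

Lemma uniq_box (n : nat) : uniq (box n).
Proof.
apply: allpairs_uniq; rewrite ?uniq_ints // => -[x y] [x' y'] _ _ /= /colP e.
by have := e 0; have := e 1; rewrite !mxE /= => -> ->.
Qed.

Lemma box0 : 0 \in box 0. Proof. by rewrite mem_box !mxE. Qed.

Lemma mem_boxD (m n : nat) (v w : 'cV[int]_2) :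
  v \in box m -> w \in box n -> v + w \in box (m + n).
Proof.
have le_absD (x y : int) : (`|x| <= m)%N -> (`|y| <= n)%N ->
  (`|(x + y)%R| <= m + n)%N by lia.
rewrite !mem_box !mxE => /andP[v0 v1] /andP[w0 w1].
by rewrite !le_absD.
Qed.

Lemma leq_box (m n : nat) (v : 'cV[int]_2) :
  (m <= n)%N -> v \in box m -> v \in box n.
Proof. by rewrite !mem_box; lia. Qed.

(** The matrix with rows (1, 1) and (1, 0), whose square is sol_mx.  All powers
    of sol_mx lie in the ring Z[fib_mx], where computations take place. *)
Definition fib_mx : 'M[int]_2 :=
  \matrix_(i < 2, j < 2) ((i == 0) || (j == 0))%:R.

Lemma fib_mx_sqr : fib_mx * fib_mx = 1 + fib_mx.
Proof.
apply/matrixP => i j; rewrite !mxE !big_ord_recl big_ord0 !mxE /=.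
by case: i j => [[|[|//]] ?] [[|[|//]] ?].
Qed.

Lemma sol_mxE : sol_mx = 1 + fib_mx.
Proof.
by apply/matrixP => i j; rewrite !mxE; case: i j => [[|[|//]] ?] [[|[|//]] ?].
Qed.

Lemma sol_mxV : sol_mx^-1 = 2 - fib_mx.
Proof.
apply: (mulrI sol_mx_unit); rewrite (mulrV sol_mx_unit) sol_mxE.
rewrite mulrDl mul1r mulrBr fib_mx_sqr [fib_mx * 2]mulr_natr mulr2n.
by rewrite opprD [fib_mx + _ + _]addrA [fib_mx + _ + _]addrAC addrK addrA subrK addrK.
Qed.

Lemma fib_mx_act (v : 'cV[int]_2) :
  fib_mx *m v = vec2 (v 0 0 + v 1 0) (v 0 0).
Proof.
rewrite [LHS]vec2_eta !mxE !big_ord_recl !big_ord0 !mxE /=.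
have -> : lift 0 0 = 1 :> 'I_2 by apply/val_inj.
by rewrite !mul1r !mul0r !addr0.
Qed.

(** The coefficient b is, up to sign, a Fibonacci number of nonzero index.  The
    induction bounds it below by the absolute value of the exponent; positivity
    of a keeps that bound going. *)
Lemma sol_mx_nonscalar (m : int) : m != 0 ->
  exists a b : int, b != 0 /\ sol_mx ^ m = a *: 1 + b *: fib_mx.
Proof.
have pos n : exists a b : int,
  [/\ 0 < a, n%:Z <= b & sol_mx ^+ n = a *: 1 + b *: fib_mx].
  elim: n => [|n [a [b [a0 b0 IH]]]].
    by exists 1, 0; split => //; rewrite expr0 scale1r scale0r addr0.
  exists (a + b), (a + b *+ 2); split; [lia | lia |].
  apply/matrixP => i j; rewrite exprSr IH sol_mxE !mxE !big_ord_recl big_ord0 !mxE.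
  by case: i j => [[|[|//]] ?] [[|[|//]] ?] /=; ring.
have neg n : exists a b : int,
  [/\ 0 < a, n%:Z <= b & sol_mx^-1 ^+ n = a *: 1 - b *: fib_mx].
  elim: n => [|n [a [b [a0 b0 IH]]]].
    by exists 1, 0; split => //; rewrite expr0 scale1r scale0r subr0.
  exists (a *+ 2 + b), (a + b); split; [lia | lia |].
  apply/matrixP => i j; rewrite exprSr IH sol_mxV mulr2n !mxE !big_ord_recl big_ord0 !mxE.
  by case: i j => [[|[|//]] ?] [[|[|//]] ?] /=; ring.
case: m => k; rewrite ?NegzE => k0.
  have [a [b [_ kb E]]] := pos k; exists a, b; split => //; lia.
have [a [b [_ kb E]]] := neg k.+1; exists a, (- b); split; first lia.
by rewrite -exprz_inv scaleNr -E.
Qed.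

(** Both sol_mx, with rows (2, 1) and (1, 1), and its inverse, with rows (1, -1)
    and (-1, 2), have absolute row sums at most 3. *)
Lemma box_sol_mx (m : int) (n : nat) (v : 'cV[int]_2) :
  v \in box n -> sol_mx ^ m *m v \in box (3 ^ `|m|%N * n).
Proof.
move=> vn.
have step (B : 'M[int]_2) k : (forall p w, w \in box p -> B *m w \in box (3 * p)) ->
    B ^+ k *m v \in box (3 ^ k * n).
  move=> B3; elim: k => [|k IH]; first by rewrite expr0 mul1mx mul1n.
  by rewrite exprS -mulmxA expnS -mulnA; exact: B3.
case: m => k.
  apply: step => p w; rewrite sol_mxE mulmxDl mul1mx fib_mx_act !mem_box !mxE /=.
  by move: (w 0 0) (w 1 0) => x y /andP[wx wy]; apply/andP; split; lia.
rewrite NegzE -exprz_inv.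
apply: step => p w.
rewrite sol_mxV mulmxBl mulr2n mulmxDl mul1mx fib_mx_act !mem_box !mxE /=.
by move: (w 0 0) (w 1 0) => x y /andP[wx wy]; apply/andP; split; lia.
Qed.

(** The form has discriminant 5, which is not a square.  The proof is by descent:
    modulo 2 the form vanishes only at (0, 0), so a zero (x, y) can be halved. *)
Lemma golden_form_anisotropic (x y : int) :
  x ^+ 2 - x * y - y ^+ 2 = 0 -> x = 0 /\ y = 0.
Proof.
have [n] := ubnP (`|x| + `|y|)%N.
elim: n x y => // n IH x y lexy form0.
have parity (z : int) : exists q, z = 2 * q \/ z = 2 * q + 1.
  by exists (z %/ 2)%Z; lia.
have [x' Ex] := parity x; have [y' Ey] := parity y.
have odd_neq0 (q : int) : 2 * q + 1 <> 0 by lia.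
have [{}Ex {}Ey] : x = 2 * x' /\ y = 2 * y'.
  case: Ex form0 => ->; case: Ey => -> form0 //; exfalso.
  (* Each witness is half of (form - 1) at the point considered. *)
  - apply: (odd_neq0 (2 * x' ^+ 2 - 2 * x' * y' - x' - 2 * y' ^+ 2 - 2 * y' - 1)).
    by rewrite -form0; ring.
  - apply: (odd_neq0 (2 * x' ^+ 2 + 2 * x' - 2 * x' * y' - y' - 2 * y' ^+ 2)).
    by rewrite -form0; ring.
  - apply: (odd_neq0 (2 * x' ^+ 2 + x' - 2 * x' * y' - 3 * y' - 2 * y' ^+ 2 - 1)).
    by rewrite -form0; ring.
have [|x0] := eqVneq x 0.
  move=> x0; move: form0; rewrite x0; split=> //; nia.
have form0' : x' ^+ 2 - x' * y' - y' ^+ 2 = 0 by nia.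
have [|x'0 y'0] := IH x' y' _ form0'; lia.
Qed.

(** * Stabilizers of vertices in Z^2 *)

(** By pigeonhole the orbit of y returns to y after at most #|` E| steps, and
    this period divides the factorial.  The exponent is the same for every f,
    which makes commensurability uniform below. *)
Lemma iter_fact_fixed (T : choiceType) (E : {fset T}) (f : T -> T) (y : T) :
  injective f -> {homo f : x / x \in E} -> y \in E -> iter (#|` E|)`! f y = y.
Proof.
move=> f_inj fE yE; set d := #|` E|.
have iterE i : iter i f y \in E by elim: i => // i /fE.
have : looping f y d.
  rewrite -[looping _ _ _]negbK -looping_uniq; apply/negP => u.
  have /(uniq_leq_size u) : {subset traject f y d.+1 <= E}.
    by move=> _ /trajectP[i _ ->].
  by rewrite size_traject ltnn.
case/trajectP => i id e.
have per : iter (d - i) f y = y.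
  have iter_inj : injective (iter i f) by elim: (i) => // k IH x z /f_inj /IH.
  by apply: iter_inj; rewrite -iterD subnKC // ltnW.
have /dvdnP[q ->] : (d - i %| d`!)%N by apply: dvdn_fact; lia.
by elim: q => // q IH; rewrite mulSn iterD IH.
Qed.

Lemma finite_bounded (T : choiceType) (E : set T) (f : T -> nat) :
  finite_set E -> exists c : nat, forall y, E y -> (f y <= c)%N.
Proof.
move=> finE; exists (\max_(y <- fset_set E) f y) => y Ey.
by apply: leq_bigmax_seq => //; rewrite in_fset_set // inE.
Qed.

Definition translation (v : 'cV[int]_2) : Sol := (v, 0).

Definition fixes (X : graph) (a : graph_action Sol X) (v : 'cV[int]_2) (x : X) :
  Prop := a (translation v) x = x.

Lemma act_comp (X : graph) (a : graph_action Sol X) (u v : 'cV[int]_2)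
    (m n : int) (x : X) :
  a (u, m) (a (v, n) x) = a (u + sol_mx ^ m *m v, m + n) x.
Proof. by rewrite -actM. Qed.

Lemma act_inj (X : graph) (a : graph_action Sol X) (g : Sol) : injective (a g).
Proof.
move=> x y /(congr1 (a g^-1%g)).
by rewrite -!actM mulVg !act1.
Qed.

Lemma act_translationD (X : graph) (a : graph_action Sol X)
    (v w : 'cV[int]_2) (m : int) (x : X) :
  a (v + w, m) x = a (translation v) (a (w, m) x).
Proof. by rewrite act_comp expr0z mul1mx add0r. Qed.

Lemma fixes0 (X : graph) (a : graph_action Sol X) (x : X) : fixes a 0 x.
Proof. exact: (act1 a). Qed.

Lemma fixesD (X : graph) (a : graph_action Sol X) (v w : 'cV[int]_2) (x : X) :
  fixes a v x -> fixes a w x -> fixes a (v + w) x.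
Proof. by rewrite /fixes act_translationD => vx ->. Qed.

Lemma fixesN (X : graph) (a : graph_action Sol X) (v : 'cV[int]_2) (x : X) :
  fixes a v x -> fixes a (- v) x.
Proof.
move=> vx; apply: (@act_inj _ a (translation v)).
by rewrite -act_translationD subrr vx; exact: fixes0.
Qed.

Lemma fixesMn (X : graph) (a : graph_action Sol X) (n : nat) (v : 'cV[int]_2)
    (x : X) :
  fixes a v x -> fixes a (v *+ n) x.
Proof.
move=> vx; elim: n => [|n IH]; first exact: fixes0.
by rewrite mulrS; exact: fixesD.
Qed.

Lemma fixesZ (X : graph) (a : graph_action Sol X) (k : int) (v : 'cV[int]_2)
    (x : X) :
  fixes a v x -> fixes a (k *: v) x.
Proof.
move=> vx; case: k => k.
  by rewrite -[Posz k]natz scaler_nat; exact: fixesMn.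
by rewrite NegzE scaleNr -[Posz _]natz scaler_nat; exact/fixesN/fixesMn.
Qed.

(** Conjugation by (u, m) acts on Z^2 as sol_mx ^ m, whatever u is. *)
Lemma fixes_act (X : graph) (a : graph_action Sol X) (u v : 'cV[int]_2)
    (m : int) (x : X) :
  fixes a v x -> fixes a (sol_mx ^ m *m v) (a (u, m) x).
Proof.
move=> vx; rewrite /fixes -act_translationD addrC.
by have := act_comp a u v m 0 x; rewrite addr0 [a (v, 0) x]vx => <-.
Qed.

Lemma iter_translation (X : graph) (a : graph_action Sol X) (n : nat)
    (v : 'cV[int]_2) (x : X) :
  iter n (a (translation v)) x = a (translation (v *+ n)) x.
Proof.
elim: n => [|n IH]; first by rewrite /= (fixes0 a x).
by rewrite iterS IH mulrS act_translationD.
Qed.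

(** With L_x the stabilizer of x in Z^2, this says n L_x <= L_y for some n > 0,
    that is, L_x meets L_y in a subgroup of finite index of L_x. *)
Definition virtually_in (X : graph) (a : graph_action Sol X) (x y : X) : Prop :=
  exists2 n : nat, (0 < n)%N & forall v, fixes a v x -> fixes a (v *+ n) y.

Definition commensurable (X : graph) (a : graph_action Sol X) (x y : X) : Prop :=
  virtually_in a x y /\ virtually_in a y x.

Lemma virtually_in_trans (X : graph) (a : graph_action Sol X) (x y z : X) :
  virtually_in a x y -> virtually_in a y z -> virtually_in a x z.
Proof.
move=> [m m0 xy] [n n0 yz]; exists (m * n)%N; first by rewrite muln_gt0 m0.
by move=> v /xy /yz; rewrite mulrnA.
Qed.

Lemma commensurable_refl (X : graph) (a : graph_action Sol X) (x : X) :
  commensurable a x x.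
Proof. by split; exists 1%N. Qed.

Lemma commensurable_trans (X : graph) (a : graph_action Sol X) (x y z : X) :
  commensurable a x y -> commensurable a y z -> commensurable a x z.
Proof.
move=> [xy yx] [yz zy].
by split; [exact: virtually_in_trans xy yz | exact: virtually_in_trans zy yx].
Qed.

(** An element fixing x permutes the neighbours of x, a finite set of size d, so
    its power of exponent d! fixes each of them. *)
Lemma virtually_in_adj (X : graph) (a : graph_action Sol X) (x y : X) :
  locally_finite X -> adj x y -> virtually_in a x y.
Proof.
move=> lfX xy; pose E := fset_set [set y : X | adj x y].
have memE z : (z \in E) = adj x z.
  by rewrite in_fset_set //; apply/idP/idP => [/set_mem|xz] //; exact: mem_set.
exists (#|` E|)`!; first exact: fact_gt0.
move=> v vx; rewrite /fixes -iter_translation.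
apply: iter_fact_fixed; rewrite ?memE //; first exact: act_inj.
by move=> z; rewrite !memE -{2}vx act_adj.
Qed.

Lemma commensurable_adj (X : graph) (a : graph_action Sol X) (x y : X) :
  locally_finite X -> adj x y -> commensurable a x y.
Proof. by move=> lfX xy; split; apply: virtually_in_adj; rewrite // adj_sym. Qed.

(** The representatives are picked inside P, so they inherit the property that
    defines P; an arbitrary transversal of the orbits would not. *)
Lemma finite_representatives (X : graph) (a : graph_action Sol X) (P : set X) :
  quasitransitive a ->
  exists T : seq X, (forall z, z \in T -> P z) /\
    forall y, P y -> exists (g : Sol) (z : X), z \in T /\ y = a g z.
Proof.
move=> qt.
have [->|/set0P[x0 Px0]] := eqVneq P set0; first by exists [::].
pose rep (o : set X) := xget x0 [set z | P z /\ Defs.orbit a z = o].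
have finT : finite_set [set rep (Defs.orbit a y) | y in P].
  rewrite -[X in finite_set X]image_comp; apply: finite_image.
  by apply: sub_finite_set qt => _ [y _ <-]; exists y.
have repP y : P y -> P (rep (Defs.orbit a y)) /\
    Defs.orbit a (rep (Defs.orbit a y)) = Defs.orbit a y.
  move=> Py; pose R := [set z | P z /\ Defs.orbit a z = Defs.orbit a y].
  by apply: (@xgetPex _ x0 R); exists y.
exists (fset_set [set rep (Defs.orbit a y) | y in P]); split.
  by move=> z; rewrite in_fset_set // => /set_mem[y Py <-]; case: (repP y Py).
move=> y Py; have [_ orb] := repP y Py.
have : Defs.orbit a (rep (Defs.orbit a y)) y by rewrite orb; exists 1%g => //; exact: act1.
case=> g _ gy; exists g, (rep (Defs.orbit a y)); split => //.
by rewrite in_fset_set // inE; exists y.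
Qed.

(** * Walks and their displacement *)

(** Every edge leaving T is of the form x -- (u, m) z with z in T, |u| <= c and
    |m| <= e.  The two bounds are separate because the case e = 0, in which
    edges move only by translations, behaves differently. *)
Definition steps (X : graph) (a : graph_action Sol X) (T : seq X) (c e : nat) :
  Prop :=
  forall x y, x \in T -> adj x y ->
    exists u m z,
      [/\ z \in T, y = a (u, m) z, u \in box c & (`|m| <= e)%N].

(** There are finitely many edges at T; choose an element of Sol for each of them.
    Either all the chosen elements are translations, or one of them is not. *)
Lemma steps_dichotomy (X : graph) (a : graph_action Sol X) (T : seq X) :
  locally_finite X ->
  (forall x y, x \in T -> adj x y ->
    exists (g : Sol) (z : X), z \in T /\ y = a g z) ->
  exists c, steps a T c 0 \/
    (steps a T c c /\
     exists x u m z, [/\ x \in T, z \in T, adj x (a (u, m) z) & m != 0]).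
Proof.
move=> lfX TX.
pose E : set X := \bigcup_(x in [set` T]) [set y | adj x y].
have finE : finite_set E by apply: bigcup_finite => // x _; exact: lfX.
have [s sP] : exists s : X -> Sol, forall y, E y ->
    exists z : X, z \in T /\ y = a (s y) z.
  have [y|s sP] := choice (P := fun y (g : Sol) => E y ->
    exists z : X, z \in T /\ y = a g z); last by exists s.
  have [[x xT xy]|nE] := pselect (E y); last by exists 1%g.
  by have [g [z ?]] := TX x y xT xy; exists g => _; exists z.
have [c1 c1P] := @finite_bounded _ E
  (fun y => maxn (absz ((s y).1 0 0)) (absz ((s y).1 1 0))) finE.
have [c2 c2P] := @finite_bounded _ E (fun y => absz (s y).2) finE.
have boxP y : E y -> (s y).1 \in box (c1 + c2).
  move=> /c1P; rewrite mem_box geq_max => /andP[l0 l1].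
  by rewrite !(leq_trans _ (leq_addr _ _)).
exists (c1 + c2)%N.
have [s0|] := pselect (forall y, E y -> (s y).2 = 0).
  left=> x y xT xy; have Ey : E y by exists x.
  have [z [zT yz]] := sP y Ey; exists (s y).1, (s y).2, z.
  by rewrite -surjective_pairing boxP // s0.
case/existsNP => y /not_implyP[Ey /eqP sy0]; right; split.
  move=> x {Ey sy0}y xT xy; have Ey : E y by exists x.
  have [z [zT yz]] := sP y Ey; exists (s y).1, (s y).2, z.
  by rewrite -surjective_pairing boxP // (leq_trans (c2P y Ey)) // leq_addl.
have [z [zT yz]] := sP y Ey; have [x xT xy] := Ey.
exists x, (s y).1, (s y).2, z.
by rewrite -surjective_pairing -yz.
Qed.

(** After r steps the Z-coordinate is at most e r in absolute value, so the next
    translation u, with |u| <= c, is stretched by at most 3^(e r). *)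
Fixpoint drift (c e r : nat) : nat :=
  if r is r'.+1 then (drift c e r' + 3 ^ (e * r') * c)%N else 0%N.

Lemma drift0 (c r : nat) : drift c 0 r = (r * c)%N.
Proof. by elim: r => //= r ->; rewrite mul0n mul1n mulSn addnC. Qed.

Lemma iter_closed_nbhd_steps (X : graph) (a : graph_action Sol X) (T : seq X)
    (c e n r : nat) (A : {fset X}) :
  locally_finite X -> steps a T c e ->
  (forall y, y \in A -> exists v z,
    [/\ z \in T, y = a (translation v) z & v \in box n]) ->
  forall y, y \in iter r (@closed_nbhd X) A -> exists v m z,
    [/\ z \in T, y = a (v, m) z, v \in box (n + drift c e r)
      & (`|m| <= e * r)%N].
Proof.
move=> lfX stT AP; elim: r => [|r IH] y.
  by move=> /AP[v [z [zT -> vn]]]; exists v, 0, z; rewrite addn0.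
rewrite iterS => /(closed_nbhdP lfX)[/IH|[x /IH]].
  move=> [v [m [z [zT -> vn mr]]]]; exists v, m, z; split => //.
    by apply: leq_box vn; rewrite /= addnA leq_addr.
  by rewrite mulnS (leq_trans mr) // leq_addl.
move=> [v [m [z [zT -> vn mr]]]].
have {1}-> : y = a (v, m) (a ((v, m) : Sol)^-1%g y) by rewrite -actM mulgV act1.
rewrite act_adj => /(stT _ _ zT)[u [m' [z' [z'T yz' uc m'e]]]].
exists (v + sol_mx ^ m *m u), (m + m'), z'; split => //.
- by rewrite -act_comp -yz' -actM mulgV act1.
- rewrite /= addnA; apply: mem_boxD => //.
  apply: leq_box (box_sol_mx m uc).
  by rewrite leq_mul2r leq_exp2l // mr orbT.
- by lia.
Qed.

Lemma card_sol_region (X : graph) (a : graph_action Sol X) (T : seq X)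
    (n k : nat) (Y : {fset X}) :
  (forall y, y \in Y -> exists v m z,
    [/\ z \in T, y = a (v, m) z, v \in box n & (`|m| <= k)%N]) ->
  (#|` Y| <= size T * n.*2.+1 ^ 2 * k.*2.+1)%N.
Proof.
move=> YP.
pose region := [seq a g z | g <- [seq (v, m) | v <- box n, m <- ints k], z <- T].
suff /uniq_leq_size : {subset Y <= region}.
  rewrite !size_allpairs !size_ints -mulnn mulnC mulnA; apply.
  exact: fset_uniq.
move=> y /YP[v [m [z [zT -> vn mk]]]]; apply: allpairs_f => //.
by apply: allpairs_f; rewrite ?mem_ints.
Qed.

Lemma mod_box (k : nat) (v : 'cV[int]_2) : (0 < k)%N ->
  exists v' w, v' \in box k /\ v = w *+ k + v'.
Proof.
move=> k0; exists (vec2 (v 0%R 0%R %% k)%Z (v 1%R 0%R %% k)%Z).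
exists (vec2 (v 0%R 0%R %/ k)%Z (v 1%R 0%R %/ k)%Z); split.
  by rewrite mem_box !mxE /=; lia.
rewrite [LHS]vec2_eta; apply/colP => i.
by rewrite [RHS]mxE mulmxnE !mxE; case: ifP => _; rewrite -mulr_natr natz -divz_eq.
Qed.

(** As k Z^2 is normal in Sol, it fixes the whole Sol-orbit of z as soon as it
    fixes z, so v matters only modulo k. *)
Lemma act_mod (X : graph) (a : graph_action Sol X) (k : nat) (z : X)
    (v : 'cV[int]_2) (m : int) :
  (0 < k)%N -> (forall w, fixes a (w *+ k) z) ->
  exists2 v', v' \in box k & a (v, m) z = a (v', m) z.
Proof.
move=> k0 kz; have [v' [w [v'k ->]]] := mod_box v k0.
exists v' => //; rewrite act_translationD.
have -> : w *+ k = sol_mx ^ m *m ((sol_mx ^ (- m) *m w) *+ k).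
  rewrite -[X in _ *m X]scaler_nat -scalemxAr mulmxA scaler_nat; congr (_ *+ k).
  rewrite -[X in X *m w]/(sol_mx ^ m * sol_mx ^ (- m)).
  by rewrite -(exprzDr sol_mx_unit) subrr expr0z mul1mx.
exact: fixes_act (kz _).
Qed.

(** * Vertices fixed by a lattice of translations *)

(** Modulo multiples of v, the vector sol_mx^m v is a nonzero multiple of
    Q v, where Q is fib_mx.  For v = (x, y) one has Q v = (x + y, x), and the
    determinant of v and Q v is the anisotropic form D = x^2 - x y - y^2.  So v
    and Q v span a lattice containing D Z^2. *)
Lemma fixes_finite_index (X : graph) (a : graph_action Sol X) (N : nat) (m : int)
    (v : 'cV[int]_2) (x : X) :
  (0 < N)%N -> m != 0 -> v != 0 ->
  fixes a (v *+ N) x -> fixes a ((sol_mx ^ m *m v) *+ N) x ->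
  exists2 k : nat, (0 < k)%N & forall w, fixes a (w *+ k) x.
Proof.
move=> N0 m0 v0 fv fAv; have [p [q [q0 Am]]] := sol_mx_nonscalar m0.
pose M := N%:Z * q; pose D := v 0 0 ^+ 2 - v 0 0 * v 1 0 - v 1 0 ^+ 2.
have D0 : D != 0.
  apply: contra_neq v0 => /golden_form_anisotropic[v00 v10].
  by rewrite [v]vec2_eta v00 v10; apply/colP => i; rewrite !mxE if_same.
have fMv : fixes a (M *: v) x.
  by rewrite /M mulrC -scalerA -[N%:Z]natz scaler_nat; exact: fixesZ.
have fMQv : fixes a (M *: (fib_mx *m v)) x.
  have -> : M *: (fib_mx *m v) =
      (sol_mx ^ m *m v) *+ N - p *: (v *+ N).
    rewrite Am mulmxDl -!scalemxAl mul1mx mulrnDl scalerMnr addrAC subrr add0r.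
    by rewrite /M mulrC -scalerA -[N%:Z]natz scaler_nat scalerMnr.
  by apply: fixesD => //; apply/fixesN/fixesZ.
have fMD w : fixes a ((M * D) *: w) x.
  (* Cramer's rule for w in terms of v and fib_mx *m v. *)
  have -> : (M * D) *: w =
      (w 0 0 * v 0 0 - w 1 0 * (v 0 0 + v 1 0)) *: (M *: v) +
      (w 1 0 * v 0 0 - w 0 0 * v 1 0) *: (M *: (fib_mx *m v)).
    rewrite fib_mx_act [in LHS](vec2_eta w); apply/colP => i; rewrite !mxE.
    have [->|] := eqVneq i 0; first by rewrite /D; ring.
    case: i => [[|[|//]] i2] // _; have -> : Ordinal i2 = 1 by exact/val_inj.
    by rewrite /D; ring.
  by apply: fixesD; exact: fixesZ.
exists (absz (M * D)).
  by rewrite absz_gt0 !mulf_neq0 // -lt0n.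
move=> w; move: (fMD w); case: (M * D) => n.
  by rewrite -[Posz n]natz scaler_nat natz.
by rewrite NegzE scaleNr -[Posz _]natz scaler_nat natz => /fixesN; rewrite opprK.
Qed.

(** A finite set of vertices is needed: the index in [virtually_in] depends on
    the vertex, and the period is multiplied by it at each of them. *)
Lemma common_period (X : graph) (a : graph_action Sol X) (T : seq X) (x : X)
    (k : nat) :
  (0 < k)%N -> (forall w, fixes a (w *+ k) x) ->
  (forall z, z \in T -> virtually_in a x z) ->
  exists2 l : nat, (0 < l)%N & forall z w, z \in T -> fixes a (w *+ l) z.
Proof.
move=> k0 kx; elim: T => [|z T IH] Tx; first by exists 1%N.
have [|l l0 lT] := IH; first by move=> y yT; apply: Tx; rewrite inE yT orbT.
have [|n n0 xz] := Tx z; first by rewrite inE eqxx.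
exists (l * (k * n))%N; first by rewrite !muln_gt0 l0 k0.
move=> y w; rewrite inE => /predU1P[->|yT].
  by rewrite mulrnA mulrnA; apply: xz; exact: kx.
by rewrite mulnC mulrnA; exact: lT.
Qed.

(** * Amenability in the three cases *)

Lemma iter_closed_nbhd_pt (X : graph) (a : graph_action Sol X) (T : seq X)
    (c e r : nat) (x : X) :
  locally_finite X -> steps a T c e -> x \in T ->
  forall y, y \in iter r (@closed_nbhd X) [fset x]%fset -> exists v m z,
    [/\ z \in T, y = a (v, m) z, v \in box (drift c e r)
      & (`|m| <= e * r)%N].
Proof.
move=> lfX stT xT; apply: (iter_closed_nbhd_steps (n := 0)) => // y.
rewrite inE => /eqP ->; exists 0, x; split => //; last exact: box0.
by rewrite (fixes0 a x).
Qed.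

(** Without stretching the drift is c r, so the ball of radius r around x lies in
    at most size T images of a box of side 2 c r + 1. *)
Lemma amenable_of_translation_steps (R : realType) (X : graph)
    (a : graph_action Sol X) (T : seq X) (c : nat) (x : X) :
  locally_finite X -> steps a T c 0 -> x \in T -> amenable R X.
Proof.
move=> lfX stT xT.
apply: (@amenable_of_quadratic_growth _ _ (size T * c.*2.+1 ^ 2)) => // r.
exists [fset x]%fset; first by rewrite -cardfs_gt0 cardfs1.
have := card_sol_region (iter_closed_nbhd_pt (r := r) lfX stT xT).
move/leq_trans; apply; rewrite drift0 mul0n cardfs1 !muln1 -mulnA leq_mul2l.
by rewrite -expnMn leq_exp2r //; lia.
Qed.

(** The exponential drift is irrelevant, since translations count only modulo
    k; what is left is the linear range of the Z-coordinate. *)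
Lemma amenable_of_fixed_lattice (R : realType) (X : graph)
    (a : graph_action Sol X) (T : seq X) (c k : nat) (x : X) :
  locally_finite X -> steps a T c c -> x \in T ->
  (0 < k)%N -> (forall z w, z \in T -> fixes a (w *+ k) z) ->
  amenable R X.
Proof.
move=> lfX stT xT k0 kT.
apply: (@amenable_of_quadratic_growth _ _ (size T * k.*2.+1 ^ 2 * c.*2.+1)) => //.
move=> r; exists [fset x]%fset; first by rewrite -cardfs_gt0 cardfs1.
have region y : y \in iter r (@closed_nbhd X) [fset x]%fset -> exists v m z,
    [/\ z \in T, y = a (v, m) z, v \in box k & (`|m| <= c * r)%N].
  case/(iter_closed_nbhd_pt lfX stT xT) => v [m [z [zT -> _ mr]]].
  have [v' v'k ->] := act_mod v m k0 (fun w => kT z w zT).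
  by exists v', m, z.
apply: leq_trans (card_sol_region region) _.
rewrite cardfs1 muln1 -[leqRHS]mulnA leq_mul2l; apply/orP; right.
by rewrite expnS; nia.
Qed.

(** Translates of x by distinct vectors are distinct, so the box A has exactly
    (2K + 1)^2 points.  Its radius K is chosen equal to the drift, so that r
    steps at most double the radius. *)
Lemma amenable_of_free_translations (R : realType) (X : graph)
    (a : graph_action Sol X) (T : seq X) (c : nat) (x : X) :
  locally_finite X -> steps a T c c -> x \in T ->
  (forall v, fixes a v x -> v = 0) ->
  amenable R X.
Proof.
move=> lfX stT xT free.
apply: (@amenable_of_quadratic_growth _ _ (4 * size T * c.*2.+1)) => // r.
set K := drift c c r.
pose A := seq_fset tt [seq a (translation v) x | v <- box K].
have cardA : #|` A| = (K.*2.+1 ^ 2)%N.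
  rewrite size_seq_fset undup_id; first by rewrite size_map size_box.
  rewrite map_inj_uniq ?uniq_box // => v w vw.
  apply/eqP; rewrite -subr_eq0; apply/eqP/free.
  by rewrite /fixes addrC act_translationD vw -act_translationD addNr; exact: fixes0.
exists A; first by rewrite -cardfs_gt0 cardA.
have AT y : y \in A -> exists v z,
    [/\ z \in T, y = a (translation v) z & v \in box K].
  by rewrite seq_fsetE => /mapP[v vK ->]; exists v, x.
apply: leq_trans (card_sol_region (iter_closed_nbhd_steps (r := r) lfX stT AT)) _.
rewrite -/K cardA; nia.
Qed.

Theorem proposition7p1 (R : realType) :
  ~ exists X : graph,
      [/\ inhabited X, locally_finite X, ~ amenable R X &
          exists a : graph_action Sol X,
            continuous_action a /\ quasitransitive a].
Proof.
move=> [X [[x0] lfX namX [a [_ qt]]]]; apply: namX.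
have [T0 [T0x0 T0P]] := finite_representatives [set z | commensurable a x0 z] qt.
pose T := x0 :: T0; have x0T : x0 \in T by rewrite inE eqxx.
have Tx0 z : z \in T -> commensurable a x0 z.
  by rewrite inE => /predU1P[->|/T0x0 //]; exact: commensurable_refl.
have T_adj x y : x \in T -> adj x y -> exists (g : Sol) (z : X),
    z \in T /\ y = a g z.
  move=> /Tx0 x0x xy; have [|g [z [zT0 yz]]] := T0P y.
    exact: commensurable_trans x0x (commensurable_adj a lfX xy).
  by exists g, z; rewrite inE zT0 orbT.
have [c [st0|[st [x [u [m [z [xT zT xz m0]]]]]]]] := steps_dichotomy lfX T_adj.
  exact: amenable_of_translation_steps st0 x0T.
have [free|] := pselect (forall v, fixes a v x0 -> v = 0).
  exact: amenable_of_free_translations st x0T free.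
case/existsNP => v /not_implyP[vx0 /eqP v0].
have [[n n0 x0z] _] := Tx0 z zT.
have [_ [n' n'0 zx0]] :=
  commensurable_trans (Tx0 x xT) (commensurable_adj a lfX xz).
have [|||k k0 kx0] := @fixes_finite_index _ a (n * n') m v x0 _ m0 v0.
- by rewrite muln_gt0 n0.
- exact: fixesMn.
- rewrite mulrnA; apply: zx0.
  have := fixes_act u m (x0z v vx0).
  by rewrite -[X in _ *m X]scaler_nat -scalemxAr scaler_nat.
have [|l l0 lT] := common_period (T := T) k0 kx0; first by move=> y /Tx0[].
exact: amenable_of_fixed_lattice st x0T l0 lT.
Qed.
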